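(* Let $n\ge 2$ and consider the interconnection $$\dot x_i\in F_i(x,u),\ i=1,\dots,n,\quad (x,u)\in\mathcal C;\qquad x_i^+\in G_i(x,u),\ i=1,\dots,n,\quad (x,u)\in\mathcal D,$$ of hybrid subsystems $\Sigma_1,\dots,\Sigma_n$ as described in the context. Suppose that each subsystem $\Sigma_i$ admits a candidate exponential ISS Lyapunov function $V_i:\mathcal X_i\to\mathbb R_+$ w.r.t. a nonempty compact set $\mathcal A_i\subset\mathcal X_i$ with rate coefficients $c_i,d_i\in\mathbb R$. Assume also that the internal gains are all linear, $r\mapsto\chi_{ij}r$ with scalars $\chi_{ij}\ge0$ (and $\chi_{ii}=0$), and that the gain matrix $\Gamma_M:=(\chi_{ij})_{i,j=1}^n\in\mathbb R^{n\times n}$ has spectral radius $\rho(\Gamma_M)<1$. Let $\sigma:r\mapsto(s_1r,\dots,s_nr)$ with scalars $s_1,\dots,s_n$ be a linear $\Omega$-path w.r.t. the operator $\bar\Gamma:\mathbb R_+^n\to\mathbb R_+^n$, $\bar\Gamma(v):=\Gamma_Mv$. Then $V:\mathcal X\to\mathbb R_+$ defined by $$V(x):=\max_{i=1}^n\frac1{s_i}V_i(x_i)$$ is a candidate exponential ISS Lyapunov function w.r.t. $\mathcal A:=\mathcal A_1\times\cdots\times\mathcal A_n$ for the interconnection with rate coefficients $$c:=\min_{i=1}^nc_i,\qquad d:=\min_{i,j:\,j\ne i}\Big\{d_i,\,-\ln\Big(\frac{s_j}{s_i}\chi_{ij}\Big)\Big\},$$ where $-\ln 0:=+\infty$.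
   Context: Notation. $\mathbb R_+=[0,\infty)$. For $v,w\in\mathbb R^n$, $v>w$ means the inequality holds in all components. $|\cdot|$ is the Euclidean norm and $|x|_{\mathcal A}=\inf_{y\in\mathcal A}|x-y|$. $\alpha:\mathbb R_+\to\mathbb R_+$ is of class $\mathcal K$ if continuous, strictly increasing and $\alpha(0)=0$; of class $\mathcal K_\infty$ if in addition unbounded. The Dini derivative of a locally Lipschitz $V$ at $x$ in direction $y$ is $\dot V(x;y):=\limsup_{h\searrow0}\frac{V(x+hy)-V(x)}{h}$ (over $h>0$ for which $V(x+hy)$ is defined). Interconnection. $x=(x_1,\dots,x_n)\in\mathcal X=\mathcal X_1\times\cdots\times\mathcal X_n\subset\mathbb R^N$ with $x_i\in\mathcal X_i\subset\mathbb R^{N_i}$ is the state; $u\in\mathcal U\subset\mathbb R^M$ is the common external input; the flow set is $\mathcal C=\mathcal C_1\times\cdots\times\mathcal C_n\times\mathcal C_u$ with $\mathcal C_i\subset\mathcal X_i$, $\mathcal C_u\subset\mathcal U$; the jump set is $\mathcal D=\mathcal D_1\times\cdots\times\mathcal D_n\times\mathcal D_u$ with $\mathcal D_i\subset\mathcal X_i$, $\mathcal D_u\subset\mathcal U$; $F=(F_1,\dots,F_n)$ with set-valued $F_i:\mathcal C\rightrightarrows\mathbb R^{N_i}$; $G=(G_1,\dots,G_n)$ with set-valued $G_i:\mathcal D\rightrightarrows\mathcal X_i$. The dynamics of $x_i$ is the subsystem $\Sigma_i$. The whole interconnection is the hybrid system $\dot x\in F(x,u)$ on $\mathcal C$, $x^+\in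 G(x,u)$ on $\mathcal D$. Candidate exponential ISS Lyapunov function for a subsystem (linear internal gains). $V_i:\mathcal X_i\to\mathbb R_+$ is a candidate exponential ISS Lyapunov function w.r.t. $\mathcal A_i$ for $\Sigma_i$ with rate coefficients $c_i,d_i\in\mathbb R$ and linear internal gains $\chi_{ij}\ge0$, $\chi_{ii}=0$, if it is locally Lipschitz outside $\mathcal A_i$ and: (1) there are $\psi_{i1},\psi_{i2}\in\mathcal K_\infty$ with $\psi_{i1}(|x_i|_{\mathcal A_i})\le V_i(x_i)\le\psi_{i2}(|x_i|_{\mathcal A_i})$ for all $x_i\in\mathcal X_i$; (2) there is an external gain $\chi_i\in\mathcal K$ such that for all $(x,u)\in\mathcal C$ with $x_i\notin\mathcal A_i$, $V_i(x_i)\ge\max\{\max_{j=1}^n\chi_{ij}V_j(x_j),\chi_i(|u|)\}$ implies $\dot V_i(x_i;y_i)\le-c_iV_i(x_i)$ for all $y_i\in F_i(x,u)$; (3) for all $(x,u)\in\mathcal D$ and all $y_i\in G_i(x,u)$, $V_i(y_i)\le\max\{e^{-d_i}V_i(x_i),\max_{j=1}^n\chi_{ij}V_j(x_j),\chi_i(|u|)\}$. Candidate exponential ISS Lyapunov function for the interconnection. For $\mathcal A\subset\mathcal X$ compact, $V:\mathcal X\to\mathbb R_+$ is a candidate exponential ISS Lyapunov function w.r.t. $\mathcal A$ with rate coefficients $c,d\in\mathbb R$ if it is locally Lipschitz outside $\mathcal A$ and: (1) there are $\psi_1,\psi_2\in\mathcal K_\infty$ with $\psi_1(|x|_{\mathcal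 A})\le V(x)\le\psi_2(|x|_{\mathcal A})$ for all $x\in\mathcal X$; (2) there is $\chi\in\mathcal K$ such that for all $(x,u)\in\mathcal C$ with $x\notin\mathcal A$, $V(x)\ge\chi(|u|)$ implies $\dot V(x;y)\le-cV(x)$ for all $y\in F(x,u)$; (3) for all $(x,u)\in\mathcal D$, with the same $\chi$, $V(x)\ge\chi(|u|)$ implies $V(y)\le e^{-d}V(x)$ for all $y\in G(x,u)$. $\Omega$-path. Given $\Gamma:\mathbb R_+^n\to\mathbb R_+^n$, a function $\sigma=(\sigma_1,\dots,\sigma_n)$ with all $\sigma_i\in\mathcal K_\infty$ is an $\Omega$-path w.r.t. $\Gamma$ if (1) all $\sigma_i^{-1}$ are locally Lipschitz on $(0,\infty)$; (2) for each compact $P\subset(0,\infty)$ there are finite $K_2>K_1>0$ such that for all $i$, $0<K_1\le(\sigma_i^{-1})'\le K_2$ at all points of differentiability of $\sigma_i^{-1}$ in $P$; (3) $\Gamma(\sigma(r))<\sigma(r)$ for all $r>0$. (In particular, for a linear $\Omega$-path all $s_i>0$.) *)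

(* Defs.v *)
From HB Require Import structures.
From mathcomp Require Import all_boot all_order all_algebra.
From mathcomp Require Import complex.
From mathcomp Require Import all_classical all_reals all_analysis.
Set Implicit Arguments.
Unset Strict Implicit.
Unset Printing Implicit Defensive.
Import Order.TTheory GRing.Theory Num.Theory.
Import numFieldNormedType.Exports.
Local Open Scope classical_set_scope.
Local Open Scope ring_scope.

(* The library norm on matrices is the sup norm, hence a separate definition. *)
Definition enorm (R : realType) (m : nat) (x : 'rV[R]_m) : R :=
  Num.sqrt (\sum_(i < m) x ord0 i ^+ 2).

(* Meaningful for nonempty [A] only, since [inf set0 = 0] in the library. *)
Definition set_dist (R : realType) (m : nat) (A : set 'rV[R]_m) (x : 'rV[R]_m)
    : R :=
  inf [set enorm (x - y) | y in A].

(* Functions on [0, +oo[ are total functions on R whose values at negative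
   arguments are irrelevant. *)
Definition class_K (R : realType) (a : R -> R) : Prop :=
  [/\ {within `[0, +oo[, continuous a},
      {in `[0, +oo[ &, {homo a : r t / r < t}} &
      a 0 = 0].

Definition class_Kinf (R : realType) (a : R -> R) : Prop :=
  class_K a /\ ~ has_ubound (a @` `[0, +oo[).

(* The function [V] is only meaningful on [X].  The filter restricts [h] to
   those [h > 0] such that [x + h *: y] lies in [X]; if there is no such small
   [h], the value is -oo. *)
Definition dini (R : realType) (m : nat) (X : set 'rV[R]_m)
    (V : 'rV[R]_m -> R) (x y : 'rV[R]_m) : \bar R :=
  limf_esup (fun h : R => ((V (x + h *: y) - V x) / h)%:E)
    (within [set h | X (x + h *: y)] 0^'+).

(* Local Lipschitz continuity does not depend on the choice of the norm, so
   the sup norm of the library is harmless here.  The library localizes at all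
   pairs (a, b) of points of [X `\` A]; near a pair with a <> b the Lipschitz
   estimate is automatic for a function that is Lipschitz near each point. *)
Definition locally_lipschitz_outside (R : realType) (m : nat)
    (X A : set 'rV[R]_m) (V : 'rV[R]_m -> R) : Prop :=
  [locally [lipschitz V x | x in X `\` A]].

Record hybrid_system (R : realType) (m k : nat) := HybridSystem {
  hs_X : set 'rV[R]_m;
  hs_U : set 'rV[R]_k;
  hs_C : set ('rV[R]_m * 'rV[R]_k);
  hs_D : set ('rV[R]_m * 'rV[R]_k);
  hs_F : 'rV[R]_m -> 'rV[R]_k -> set 'rV[R]_m;
  hs_G : 'rV[R]_m -> 'rV[R]_k -> set 'rV[R]_m;
  hs_CXU : hs_C `<=` hs_X `*` hs_U;
  hs_DXU : hs_D `<=` hs_X `*` hs_U;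
  hs_GX : forall x u, hs_D (x, u) -> hs_G x u `<=` hs_X }.

Definition exp_ISS_lyapunov (R : realType) (m k : nat)
    (H : hybrid_system R m k) (A : set 'rV[R]_m) (V : 'rV[R]_m -> R)
    (c d : R) : Prop :=
  [/\ [/\ A !=set0, compact A & A `<=` hs_X H],
      forall x, hs_X H x -> 0 <= V x,
      locally_lipschitz_outside (hs_X H) A V,
      exists psi1 psi2 : R -> R,
        [/\ class_Kinf psi1, class_Kinf psi2 &
            forall x, hs_X H x ->
              psi1 (set_dist A x) <= V x <= psi2 (set_dist A x)] &
      exists chi : R -> R,
        [/\ class_K chi,
            forall x u, hs_C H (x, u) -> ~ A x -> chi (enorm u) <= V x ->
              forall y, hs_F H x u y ->
                (dini (hs_X H) V x y <= (- c * V x)%:E)%E &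
            forall x u, hs_D H (x, u) -> chi (enorm u) <= V x ->
              forall y, hs_G H x u y -> V y <= expR (- d) * V x]].

(* A state of the interconnection is the concatenation of the states of the
   subsystems; [submxrow x i] is the component [x_i] of [x]. *)
Definition setprod_blocks (R : realType) (n : nat) (N : 'I_n -> nat)
    (B : forall i : 'I_n, set 'rV[R]_(N i)) : set 'rV[R]_(\sum_i N i) :=
  [set x | forall i, B i (submxrow x i)].

Record interconnection (R : realType) (n : nat) (N : 'I_n -> nat) (M : nat) :=
  Interconnection {
  ic_X : forall i : 'I_n, set 'rV[R]_(N i);
  ic_U : set 'rV[R]_M;
  ic_C : forall i : 'I_n, set 'rV[R]_(N i);
  ic_Cu : set 'rV[R]_M;
  ic_D : forall i : 'I_n, set 'rV[R]_(N i);
  ic_Du : set 'rV[R]_M;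
  ic_F : forall i : 'I_n,
    'rV[R]_(\sum_i N i) -> 'rV[R]_M -> set 'rV[R]_(N i);
  ic_G : forall i : 'I_n,
    'rV[R]_(\sum_i N i) -> 'rV[R]_M -> set 'rV[R]_(N i);
  ic_CX : forall i, @ic_C i `<=` @ic_X i;
  ic_CuU : ic_Cu `<=` ic_U;
  ic_DX : forall i, @ic_D i `<=` @ic_X i;
  ic_DuU : ic_Du `<=` ic_U;
  ic_GX : forall i x u, setprod_blocks (@ic_D) x -> ic_Du u ->
    @ic_G i x u `<=` @ic_X i }.

Arguments ic_X {R n N M} _ i _.
Arguments ic_C {R n N M} _ i _.
Arguments ic_D {R n N M} _ i _.
Arguments ic_F {R n N M} _ i _ _ _.
Arguments ic_G {R n N M} _ i _ _ _.

Definition flow_set (R : realType) (n : nat) (N : 'I_n -> nat) (M : nat)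
    (S : interconnection R N M) : set ('rV[R]_(\sum_i N i) * 'rV[R]_M) :=
  setprod_blocks (ic_C S) `*` ic_Cu S.

Definition jump_set (R : realType) (n : nat) (N : 'I_n -> nat) (M : nat)
    (S : interconnection R N M) : set ('rV[R]_(\sum_i N i) * 'rV[R]_M) :=
  setprod_blocks (ic_D S) `*` ic_Du S.

Section whole_system.
Variables (R : realType) (n : nat) (N : 'I_n -> nat) (M : nat).
Variable S : interconnection R N M.

Let X := setprod_blocks (ic_X S).
Let F x u := setprod_blocks (fun i => ic_F S i x u).
Let G x u := setprod_blocks (fun i => ic_G S i x u).

Lemma flow_set_sub : flow_set S `<=` X `*` ic_U S.
Proof.
by move=> [x u] [/= xC uC]; split=> [i|]; [exact/ic_CX/xC | exact/ic_CuU].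
Qed.

Lemma jump_set_sub : jump_set S `<=` X `*` ic_U S.
Proof.
by move=> [x u] [/= xD uD]; split=> [i|]; [exact/ic_DX/xD | exact/ic_DuU].
Qed.

Lemma jump_map_sub x u : jump_set S (x, u) -> G x u `<=` X.
Proof. by move=> [/= xD uD] y Gy i; exact: (ic_GX xD uD (Gy i)). Qed.

Definition whole_system : hybrid_system R (\sum_i N i) M :=
  @HybridSystem R (\sum_i N i)%N M X (ic_U S) (flow_set S) (jump_set S) F G
    flow_set_sub jump_set_sub jump_map_sub.

End whole_system.

(* [V] is the whole family of functions because the conditions on subsystem
   [i] involve the internal inputs [V j (x_j)].  All the terms of the maximum
   over [j] are nonnegative on the state space, so 0 is a neutral default
   value. *)
Definition exp_ISS_lyapunov_sub (R : realType) (n : nat) (N : 'I_n -> nat)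
    (M : nat) (S : interconnection R N M) (chi : 'M[R]_n)
    (V : forall i : 'I_n, 'rV[R]_(N i) -> R) (i : 'I_n)
    (A : set 'rV[R]_(N i)) (c d : R) : Prop :=
  [/\ forall z, ic_X S i z -> 0 <= V i z,
      locally_lipschitz_outside (ic_X S i) A (V i),
      exists psi1 psi2 : R -> R,
        [/\ class_Kinf psi1, class_Kinf psi2 &
            forall z, ic_X S i z ->
              psi1 (set_dist A z) <= V i z <= psi2 (set_dist A z)] &
      exists chiu : R -> R,
        [/\ class_K chiu,
            forall x u, flow_set S (x, u) -> ~ A (submxrow x i) ->
              Num.max (\big[Num.max/0]_(j < n) (chi i j * V j (submxrow x j)))
                (chiu (enorm u)) <= V i (submxrow x i) ->
              forall y, ic_F S i x u y ->
                (dini (ic_X S i) (V i) (submxrow x i) y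
                   <= (- c * V i (submxrow x i))%:E)%E &
            forall x u, jump_set S (x, u) -> forall y, ic_G S i x u y ->
              V i y <=
                Num.max (expR (- d) * V i (submxrow x i))
                  (Num.max
                    (\big[Num.max/0]_(j < n) (chi i j * V j (submxrow x j)))
                    (chiu (enorm u)))]].

Definition spectral_radius (R : realType) (n : nat) (A : 'M[R]_n) : R :=
  sup [set complex.Re `|z|
      | z in [set z : R[i] | eigenvalue (map_mx (real_complex R) A) z]].

(* Inverse of a function of class Kinf, as a function on [0, +oo[. *)
Definition Kinf_inv (R : realType) (a : R -> R) : R -> R :=
  'pinv_(fun=> 0) `[0, +oo[ a.

Definition Omega_path (R : realType) (n : nat)
    (Gam : 'cV[R]_n -> 'cV[R]_n) (sigma : 'I_n -> R -> R) : Prop :=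
  [/\ forall i, class_Kinf (sigma i),
      forall i, [locally [lipschitz (Kinf_inv (sigma i) r : R)
                         | r in (`]0, +oo[ : set R)]],
      forall P : set R, compact P -> P `<=` `]0, +oo[ ->
        exists K1 K2 : R, 0 < K1 < K2 /\
          forall i r, P r -> derivable (Kinf_inv (sigma i)) r 1 ->
            K1 <= derive1 (Kinf_inv (sigma i)) r <= K2 &
      forall r, 0 < r ->
        forall i, Gam (\col_j sigma j r) i ord0 < sigma i r].

(* The minima below are taken in the extended reals; for [n > 0] they are
   finite. *)
Definition flow_rate (R : realType) (n : nat) (c : 'I_n -> R) : R :=
  fine (\big[Order.min/+oo%E]_(i < n) (c i)%:E).

(* [lne 0 = -oo], so that the terms with [chi i j = 0] equal +oo. *)
Definition jump_rate (R : realType) (n : nat) (d s : 'I_n -> R)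
    (chi : 'M[R]_n) : R :=
  fine (\big[Order.min/+oo%E]_(i < n) \big[Order.min/+oo%E]_(j < n | j != i)
    Order.min (d i)%:E (- lne (s j / s i * chi i j)%:E)%E).

(* Main.v *)
Require Import Defs.
From HB Require Import structures.
From mathcomp Require Import all_boot all_order all_algebra.
From mathcomp Require Import all_classical all_reals all_analysis.
From mathcomp Require Import ring lra.
Set Implicit Arguments.
Unset Strict Implicit.
Unset Printing Implicit Defensive.
Import Order.TTheory GRing.Theory Num.Theory.
Import numFieldNormedType.Exports.
Local Open Scope classical_set_scope.
Local Open Scope ring_scope.

(** Write [W x] for the maximum of the [V i (x_i) / s i], and call an index
    [i] active at [x] when it attains this maximum, so that
    [V i (x_i) = s i * W x].

    The [s i] are chosen so that an active subsystem is one whose own decrease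
    condition is in force.  The defining inequality of the path at [r = 1] gives
    [chi i j * s j <= s i], and always [V j (x_j) <= s j * W x]; hence every
    internal input of an active subsystem satisfies
    [chi i j * V j (x_j) <= s i * W x = V i (x_i)].  If moreover [W x] dominates
    a common bound of the rescaled external gains, then
    [V i (x_i)] decreases at rate [c i] along the flow.

    To transfer this decrease to [W] one needs that close to [x] only indices
    active at [x] can be active ([active_near]).  This is a statement about
    continuity of each [V i] on its whole state space, including the points of
    [A i], where no Lipschitz condition is assumed; there [V i] vanishes
    and is squeezed by its upper bound ([lyapunov_continuous]).  Consequently,
    for [a] and [b] close to [x], the difference [W a - W b] is at most the one
    of [V i / s i] for some [i] active at [x].  This gives both local Lipschitz
    continuity ([max_locally_lipschitz]: an active index has [V i (x_i) > 0],
    so [x_i] is outside [A i]) and the bound on the Dini derivative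
    ([dini_max_le]).

    For the jumps, the three terms bounding [V i (y_i) / s i] are estimated by
    [W x] separately.  The first two give the factors [e^(- d i)] and
    [s j / s i * chi i j], both at most [e^(- d)] by definition of the jump
    rate [d].  The external term would only be bounded by [W x] itself,
    so the external gain of the interconnection is enlarged by the factor
    [1 + e^d].

    The sandwich bounds on [W] ([max_sandwich]) come from comparing the
    distance to a product with the distances of the blocks. *)

(** * Comparison functions *)

Section class_K_theory.
Context {R : realType}.
Implicit Types (f g : R -> R).

Lemma class_K_ge0 f r : class_K f -> 0 <= r -> 0 <= f r.
Proof.
move=> [_ finc f0]; rewrite le_eqVlt => /predU1P[<-|r0]; first by rewrite f0.
by rewrite -[leLHS]f0 ltW// finc// in_itv/= ?lexx// ltW.
Qed.

Lemma class_K_gt0 f r : class_K f -> 0 < r -> 0 < f r.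
Proof.
move=> [_ finc f0] r0.
by rewrite -[ltLHS]f0 finc// in_itv/= ?lexx// ltW.
Qed.

Lemma class_K_le f r t : class_K f -> 0 <= r -> r <= t -> f r <= f t.
Proof.
move=> [_ finc _] r0; rewrite le_eqVlt => /predU1P[->//|rt].
by rewrite ltW// finc// in_itv/= andbT// ltW// (le_lt_trans r0).
Qed.

Lemma class_Kinf_exceeds f : class_Kinf f ->
  forall M, exists2 r, 0 <= r & M < f r.
Proof.
move=> [_ nub] M; apply: contrapT => noex; apply: nub; exists M => _ [r r0 <-].
rewrite leNgt; apply/negP => Mf; apply: noex; exists r => //.
by move: r0; rewrite /= in_itv/= andbT.
Qed.

Lemma class_Kinf_of_exceeds f : class_K f ->
  (forall M, exists2 r, 0 <= r & M < f r) -> class_Kinf f.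
Proof.
move=> Kf unb; split=> // -[M ubM]; have [r r0] := unb M.
rewrite ltNge => /negP; apply; apply: ubM; exists r => //=.
by rewrite in_itv/= r0.
Qed.

Lemma class_Kinf_id : class_Kinf (@id R).
Proof.
apply: class_Kinf_of_exceeds.
  by split=> //; apply: continuous_subspaceT => x; exact: cvg_id.
move=> M; exists (`|M| + 1); first by rewrite addr_ge0.
by rewrite ltr_pwDr// ler_norm.
Qed.

Lemma class_KD f g : class_K f -> class_K g -> class_K (fun r => f r + g r).
Proof.
move=> [/subspace_continuousP cf finc f0] [/subspace_continuousP cg ginc g0].
split.
- by apply/subspace_continuousP => x x0; apply: cvgD; [exact: cf|exact: cg].
- by move=> r t r0 t0 rt; rewrite ltrD ?finc ?ginc.
- by rewrite f0 g0 addr0.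
Qed.

Lemma class_KZ a f : 0 < a -> class_K f -> class_K (fun r => a * f r).
Proof.
move=> a0 [/subspace_continuousP cf finc f0]; split.
- apply/subspace_continuousP => x x0; apply: cvgM; last exact: cf.
  exact: cvg_cst.
- by move=> r t r0 t0 rt; rewrite ltr_pM2l ?finc.
- by rewrite f0 mulr0.
Qed.

Lemma class_KinfZ a f : 0 < a -> class_Kinf f -> class_Kinf (fun r => a * f r).
Proof.
move=> a0 Kf; apply: class_Kinf_of_exceeds; first exact: class_KZ Kf.1.
move=> M; have [r r0 Mf] := class_Kinf_exceeds Kf (a^-1 * M).
by exists r => //; rewrite -ltr_pdivrMl.
Qed.

Lemma class_Kinf_scale a f : 0 < a -> class_Kinf f ->
  class_Kinf (fun r => f (a * r)).
Proof.
move=> a0 Kf; have [[/subspace_continuousP cf finc f0] _] := Kf.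
have mem r : (0 <= r -> 0 <= a * r) by move=> r0; rewrite mulr_ge0// ltW.
apply: class_Kinf_of_exceeds; last first.
  move=> M; have [r r0 Mf] := class_Kinf_exceeds Kf M.
  by exists (a^-1 * r); rewrite ?mulr_ge0 ?invr_ge0 ?(ltW a0)// mulVKf ?gt_eqF.
split.
- apply/subspace_continuousP => x; rewrite /= in_itv/= andbT => x0.
  have ax0 : `[0, +oo[%classic (a * x) by rewrite /= in_itv/= andbT mem.
  have ca : a * r @[r --> x] --> a * x.
    by apply: cvgM; [exact: cvg_cst|exact: cvg_id].
  move=> U /(cf _ ax0) /ca; rewrite /= !nbhs_simpl/=; apply: filterS => r Ur.
  by rewrite /= in_itv/= andbT => /mem r0; apply: Ur; rewrite /= in_itv/= andbT.
- move=> r t; rewrite !in_itv/= !andbT => r0 t0 rt.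
  by apply: finc; rewrite ?in_itv/= ?andbT ?mem// ltr_pM2l.
- by rewrite mulr0.
Qed.

(** The minimum is unbounded because both functions are nondecreasing: it
    exceeds a bound as soon as the argument is beyond a point where each of
    them does. *)
Lemma class_Kinf_min f g : class_Kinf f -> class_Kinf g ->
  class_Kinf (fun r => Num.min (f r) (g r)).
Proof.
move=> Kf Kg; have [[cf finc f0] _] := Kf.
have [[cg ginc g0] _] := Kg.
apply: class_Kinf_of_exceeds; last first.
  move=> M; have [r r0 Mf] := class_Kinf_exceeds Kf M.
  have [t t0 Mg] := class_Kinf_exceeds Kg M.
  exists (Num.max r t); first by rewrite le_max r0.
  rewrite lt_min (lt_le_trans Mf) ?(lt_le_trans Mg)//=.
  - by apply: class_K_le Kg.1 _ _ => //; rewrite le_max lexx orbT.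
  - by apply: class_K_le Kf.1 _ _ => //; rewrite le_max lexx.
split.
- by move=> x; apply: continuous_min; [exact: cf|exact: cg].
- move=> r t r0 t0 rt; rewrite lt_min !gt_min finc ?ginc ?orbT//.
- by rewrite f0 g0 minxx.
Qed.

Lemma class_Kinf_lower (I : finType) (f : I -> R -> R) :
  (forall i, class_Kinf (f i)) ->
  exists2 g, class_Kinf g & forall i r, g r <= f i r.
Proof.
move=> Kf.
suff [g Kg gf] : exists2 g, class_Kinf g &
    forall i, i \in enum I -> forall r, g r <= f i r.
  by exists g => // i; apply: gf; rewrite mem_enum.
elim: (enum I) => [|i s [g Kg gf]].
  by exists id => //; exact: class_Kinf_id.
exists (fun r => Num.min (f i r) (g r)); first exact: class_Kinf_min.
move=> j; rewrite inE => /predU1P[->|js] r; rewrite ge_min ?lexx//.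
by rewrite gf ?orbT.
Qed.

(** The envelope is unbounded even if the [f i] are not: this lets a
    single lemma serve for the upper bounds and for the external gains. *)
Lemma class_K_upper (I : finType) (f : I -> R -> R) :
  (forall i, class_K (f i)) ->
  exists2 g, class_Kinf g & forall i r, 0 <= r -> f i r <= g r.
Proof.
move=> Kf.
suff [g Kg gf] : exists2 g, class_Kinf g &
    forall i, i \in enum I -> forall r, 0 <= r -> f i r <= g r.
  by exists g => // i; apply: gf; rewrite mem_enum.
elim: (enum I) => [|i s [g Kg gf]].
  by exists id => //; exact: class_Kinf_id.
exists (fun r => f i r + g r).
  apply: class_Kinf_of_exceeds; first exact: class_KD Kg.1.
  move=> M; have [r r0 Mg] := class_Kinf_exceeds Kg M.
  by exists r => //; rewrite (lt_le_trans Mg)// lerDr class_K_ge0.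
move=> j; rewrite inE => /predU1P[->|js] r r0.
  by rewrite lerDl (class_K_ge0 Kg.1).
by rewrite (le_trans (gf j js r r0))// lerDr class_K_ge0.
Qed.

End class_K_theory.

(** * Euclidean distances and block decompositions *)

Section euclidean_distance.
Context {R : realType} {m : nat}.
Implicit Types (A : set 'rV[R]_m) (x y : 'rV[R]_m).

Lemma enorm_ge0 x : 0 <= enorm x.
Proof. exact: sqrtr_ge0. Qed.

Lemma enorm_sqr x : enorm x ^+ 2 = \sum_(i < m) x ord0 i ^+ 2.
Proof. by rewrite sqr_sqrtr// sumr_ge0// => i _; exact: sqr_ge0. Qed.

Lemma enorm0 : enorm (0 : 'rV[R]_m) = 0.
Proof.
by rewrite /enorm big1 ?sqrtr0// => i _; rewrite mxE expr0n.
Qed.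

(** The topology of the library comes from the sup norm; this comparison and
    [enorm_continuous] relate it to the Euclidean norm. *)
Lemma mx_norm_le_enorm x : `|x| <= enorm x.
Proof.
rewrite [leLHS]/Num.norm/= mx_normrE; apply: bigmax_le => [|[i j] _ /=].
  exact: enorm_ge0.
rewrite (ord1 i) -(ler_pXn2r (_ : 0 < 2)%N)// ?nnegrE ?enorm_ge0//.
rewrite real_normK ?num_real// enorm_sqr (bigD1 j)//= lerDl sumr_ge0// => k _.
exact: sqr_ge0.
Qed.

Lemma enorm_continuous : continuous (@enorm R m).
Proof.
have sum_sqr_continuous : continuous (fun x : 'rV[R]_m => \sum_i x ord0 i ^+ 2).
  move=> x; have nbhsF : Filter (nbhs x) by exact: nbhs_filter.
  apply: cvg_big => [|i _]; first exact: add_continuous.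
  by apply: cvgM; exact: coord_continuous.
move=> x; apply: continuous_comp; first exact: sum_sqr_continuous.
exact: sqrt_continuous.
Qed.

Lemma set_dist_lbound A x : has_lbound [set enorm (x - y) | y in A].
Proof. by exists 0 => _ [y _ <-]; exact: enorm_ge0. Qed.

Lemma set_dist_le A x y : A y -> set_dist A x <= enorm (x - y).
Proof. by move=> Ay; apply: ge_inf; [exact: set_dist_lbound|exists y]. Qed.

Lemma le_set_dist A x e : A !=set0 -> (forall y, A y -> e <= enorm (x - y)) ->
  e <= set_dist A x.
Proof.
move=> [a Aa] le_e; apply: lb_le_inf; first by exists (enorm (x - a)), a.
by move=> _ [y Ay <-]; exact: le_e.
Qed.

Lemma set_dist_ge0 A x : A !=set0 -> 0 <= set_dist A x.
Proof. by move=> A0; apply: le_set_dist => // y _; exact: enorm_ge0. Qed.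

Lemma set_dist_eq0 A x : A x -> set_dist A x = 0.
Proof.
move=> Ax; apply/eqP; rewrite eq_le set_dist_ge0 ?andbT//; last by exists x.
by have := set_dist_le x Ax; rewrite subrr enorm0.
Qed.

(** A sup-norm ball around [x] misses [A], and the Euclidean norm dominates the
    sup norm. *)
Lemma set_dist_gt0 A x : A !=set0 -> closed A -> ~ A x -> 0 < set_dist A x.
Proof.
move=> A0 clA nAx.
have /nbhs_ballP[e /= e0 eA] : nbhs x (~` A).
  by apply: open_nbhs_nbhs; split => //; exact: closed_openC.
apply: (lt_le_trans e0); apply: le_set_dist => // y Ay.
apply: le_trans (mx_norm_le_enorm _); rewrite leNgt; apply/negP => xye.
by apply: (eA y) => //; rewrite -ball_normE.
Qed.

Lemma set_dist_near A x e : A !=set0 -> 0 < e ->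
  exists2 y, A y & enorm (x - y) < set_dist A x + e.
Proof.
move=> [a Aa] e0.
have [|_ [y Ay <-] ye] := @inf_adherent _ [set enorm (x - y) | y in A] e e0.
  by split; [exists (enorm (x - a)), a|exact: set_dist_lbound].
by exists y.
Qed.

End euclidean_distance.

Section blocks.
Context {R : realType} {n : nat} {N : 'I_n -> nat}.
Implicit Types (x y : 'rV[R]_(\sum_i N i)) (A : forall i, set 'rV[R]_(N i)).

(** Both sides are entries of [x *m x^T], computed with or without the block
    decomposition. *)
Lemma enorm_blocks x : enorm x ^+ 2 = \sum_i enorm (submxrow x i) ^+ 2.
Proof.
have sqrE m (z : 'rV[R]_m) : (z *m z^T) ord0 ord0 = enorm z ^+ 2.
  by rewrite enorm_sqr mxE; apply: eq_bigr => i _; rewrite mxE expr2.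
rewrite -sqrE -[in LHS](submxrowK x) tr_mxrow mul_mxrow_mxcol summxE.
by apply: eq_bigr => i _; rewrite sqrE.
Qed.

Lemma enorm_block_le x i : enorm (submxrow x i) <= enorm x.
Proof.
rewrite -(ler_pXn2r (_ : 0 < 2)%N)// ?nnegrE ?enorm_ge0//.
by rewrite enorm_blocks (bigD1 i)//= lerDl sumr_ge0// => j _; exact: sqr_ge0.
Qed.

Lemma enorm_le_sum_blocks x : enorm x <= \sum_i enorm (submxrow x i).
Proof.
have S0 (P : pred 'I_n) : 0 <= \sum_(i | P i) enorm (submxrow x i).
  by apply: sumr_ge0 => i _; exact: enorm_ge0.
rewrite -(ler_pXn2r (_ : 0 < 2)%N)// ?nnegrE ?enorm_ge0//.
rewrite enorm_blocks expr2 mulr_suml; apply: ler_sum => i _.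
by rewrite expr2 ler_wpM2l ?enorm_ge0// (bigD1 i)//= lerDl.
Qed.

Lemma setprod_blocks_nonempty A : (forall i, A i !=set0) ->
  setprod_blocks A !=set0.
Proof.
move=> A0; exists (\mxrow_i projT1 (cid (A0 i))) => j.
by rewrite mxrowK; exact: projT2 (cid (A0 j)).
Qed.

Lemma set_dist_block_le A x i : (forall i, A i !=set0) ->
  set_dist (A i) (submxrow x i) <= set_dist (setprod_blocks A) x.
Proof.
move=> A0; apply: le_set_dist; first exact: setprod_blocks_nonempty.
move=> y Ay; apply: le_trans (set_dist_le _ (Ay i)) _.
by rewrite -submxrowB; exact: enorm_block_le.
Qed.

(** The distances need not be attained: the point of the product is assembled
    from points of the [A i] that are optimal up to a share of [e]. *)
Lemma set_dist_le_sum_blocks A x : (forall i, A i !=set0) ->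
  set_dist (setprod_blocks A) x <= \sum_i set_dist (A i) (submxrow x i).
Proof.
move=> A0; apply/ler_addgt0Pr => e e0.
have n0 : 0 < n.+1%:R^-1 * e by rewrite mulr_gt0 ?invr_gt0.
have near i := cid2 (set_dist_near (submxrow x i) (A0 i) n0).
pose y := \mxrow_i s2val (near i).
have Ay : setprod_blocks A y.
  by move=> i; rewrite /y mxrowK; exact: s2valP (near i).
apply: (le_trans (set_dist_le x Ay)); apply: (le_trans (enorm_le_sum_blocks _)).
apply: (@le_trans _ _
  (\sum_i (set_dist (A i) (submxrow x i) + n.+1%:R^-1 * e))).
  apply: ler_sum => i _; rewrite submxrowB /y mxrowK ltW//.
  exact: s2valP' (near i).
(* The share is [e / (n + 1)], which is positive also when [n = 0]. *)
rewrite big_split/= lerD2l sumr_const card_ord -mulrnAl -mulr_natr.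
rewrite ler_piMl ?(ltW e0)// mulrC ler_pdivrMr// mul1r ler_nat.
exact: leqnSn.
Qed.

Lemma mx_norm_block_le x i : `|submxrow x i| <= `|x|.
Proof.
rewrite [leLHS]/Num.norm/= mx_normrE; apply: bigmax_le => // -[k j] _ /=.
rewrite mxE [leRHS]/Num.norm/= mx_normrE.
exact: (@le_bigmax _ _ _ _ (fun kj => `|x kj.1 kj.2|) (k, tagnat.Rank i j)).
Qed.

Lemma submxrow_continuous i : continuous (fun x => submxrow x i).
Proof.
move=> x; have nbhsF := nbhs_filter x.
apply/cvgrPdist_le => /= e e0.
apply: filterS (nbhsx_ballx x _ e0) => y.
rewrite -ball_normE /= -submxrowB => /ltW.
exact: le_trans (mx_norm_block_le _ _).
Qed.

Lemma setprod_blocks_compact A : (forall i, compact (A i)) ->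
  compact (setprod_blocks A).
Proof.
move=> cA; apply: bounded_closed_compact; last first.
  rewrite (_ : setprod_blocks A =
      \bigcap_(i in setT) (fun x => submxrow x i) @^-1` A i); last first.
    by apply/seteqP; split => [x Ax i _ /=|x Ax i]; [exact: Ax|exact: (Ax i)].
  apply: closed_bigI => i _; apply: preimage_closed.
    by move=> x _; exact: submxrow_continuous.
  exact: compact_closed (@norm_hausdorff _ _) (cA i).
have /choice[C bC] : forall i, exists C, forall z, A i z -> `|z| <= C.
  move=> i; have [C [_ bC]] := compact_bounded (cA i).
  by exists (C + 1) => z; apply: bC; rewrite ltrDl.
exists (\sum_i `|C i|); split; first exact: num_real.
move=> M ltM x Ax; apply: (le_trans _ (ltW ltM)).
rewrite [leLHS]/Num.norm/= mx_normrE; apply: bigmax_le => [|[k j] _ /=].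
  by apply: sumr_ge0.
have -> : x k j = submxrow x (tagnat.sig1 j) k (tagnat.sig2 j).
  by rewrite mxE tagnat.sig2K.
apply: (@le_trans _ _ `|submxrow x (tagnat.sig1 j)|).
  rewrite [leRHS]/Num.norm/= mx_normrE.
  exact: (@le_bigmax _ _ _ _ (fun kj => `|_ kj.1 kj.2|) (k, _)).
rewrite (le_trans (bC _ _ (Ax _)))// (le_trans (ler_norm _))//.
by rewrite (bigD1 (tagnat.sig1 j))//= lerDl sumr_ge0.
Qed.

End blocks.

(** * Active indices, local Lipschitz continuity and Dini derivatives *)

Section active_indices.
Context {R : realType} {n : nat}.

Lemma bigmax_attained (f : 'I_n -> R) : (0 < n)%N -> (forall i, 0 <= f i) ->
  exists i, \big[Num.max/0]_(j < n) f j = f i.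
Proof.
move=> n0 f0.
have [i _ fi] := @eq_bigmax _ _ _ 0 (Ordinal n0) xpredT f isT (fun i _ => f0 i).
by exists i.
Qed.

(** An index that is not active in the limit stays strictly below a fixed active
    one: the midpoint of the two limits separates them eventually.  The filter
    is arbitrary, since the values are only compared with their limits. *)
Lemma active_near {T : Type} (F : set_system T) {FF : Filter F}
    (W : 'I_n -> T -> R) (l : 'I_n -> R) :
  (forall i, 0 <= l i) -> (forall i, W i z @[z --> F] --> l i) ->
  \forall z \near F, forall i, W i z = \big[Num.max/0]_(j < n) W j z ->
    l i = \big[Num.max/0]_(j < n) l j.
Proof.
move=> l0 Wl; apply: filter_forall => i.
have [k maxk] := bigmax_attained (leq_ltn_trans (leq0n i) (ltn_ord i)) l0.
have [->|li] := eqVneq (l i) (\big[Num.max/0]_(j < n) l j); first exact: nearW.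
have {}li : l i < l k by rewrite lt_neqAle -maxk li le_bigmax.
have [lim limk] := midf_lt li.
near=> z => Wiz; exfalso.
have Wi : W i z < (l i + l k) / 2 by near: z; exact: cvgr_lt (Wl i) _ lim.
have Wk : (l i + l k) / 2 < W k z by near: z; exact: cvgr_gt (Wl k) _ limk.
have : W k z <= W i z by rewrite Wiz le_bigmax.
by rewrite leNgt (lt_trans Wi Wk).
Unshelve. all: by end_near. Qed.

End active_indices.

Section local_lipschitz.
Context {R : realType} {m : nat}.
Implicit Types (X A : set 'rV[R]_m) (V : 'rV[R]_m -> R).

(** Restriction to the diagonal pair [(x, x)].  As the complement of [A] is a
    neighborhood of [x], the ball can be taken to avoid [A], so that only
    membership in [X] remains to be checked. *)
Lemma locally_lipschitz_outside_ball X A V x :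
  locally_lipschitz_outside X A V -> closed A -> X x -> ~ A x ->
  exists M e, [/\ 0 <= M, 0 < e & forall a b, ball x e a -> ball x e b ->
    X a -> X b -> `|V a - V b| <= M * `|a - b|].
Proof.
move=> lipV clA Xx nAx.
have /pinfty_ex_gt0[M M0 VM] := lipV (x, x) (conj (conj Xx nAx) (conj Xx nAx)).
have /nbhs_ballP[e e0 eA] : nbhs x (~` A).
  by apply: open_nbhs_nbhs; split => //; exact: closed_openC.
move: VM => /nbhs_ballP[e' e'0 VM].
exists M, (Num.min e e'); split; [exact: ltW|by rewrite lt_min e0 e'0|].
move=> a b xa xb Xa Xb; apply: (VM (a, b)) => /=.
- by split; [apply: le_ball xa|apply: le_ball xb]; rewrite ge_min lexx orbT.
- by split; split => //; apply: eA; [apply: le_ball xa|apply: le_ball xb];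
    rewrite ge_min lexx.
Qed.

(** Near an off-diagonal pair [(p, q)] the values differ by at most a constant
    [C], while the distance of the arguments stays above [`|p - q| / 2]: there
    [C] divided by this bound is a Lipschitz constant. *)
Lemma locally_lipschitz_outside_of_ball X A V :
  (forall x, X x -> ~ A x ->
    exists M e, [/\ 0 <= M, 0 < e & forall a b, ball x e a -> ball x e b ->
      X a -> X b -> `|V a - V b| <= M * `|a - b|]) ->
  locally_lipschitz_outside X A V.
Proof.
move=> lipV [p q] [/= [Xp nAp] [Xq nAq]].
have [M [e [M0 e0 VM]]] := lipV p Xp nAp.
suff [K [d [d0 VK]]] : exists K d, 0 < d /\
    forall a b, ball p d a -> ball q d b -> X a -> X b ->
      `|V a - V b| <= K * `|a - b|.
  exists `|K|; split; first exact: num_real.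
  move=> L KL; apply/nbhs_ballP; exists d => //=.
  move=> [a b] /= [pa qb] [[Xa _] [Xb _]].
  rewrite (le_trans (VK _ _ pa qb Xa Xb))// ler_wpM2r//.
  by rewrite ltW// (le_lt_trans (ler_norm _)).
have [<-{q Xq nAq}|pq] := eqVneq p q; first by exists M, e.
have [M' [e' [M'0 e'0 VM']]] := lipV q Xq nAq.
pose D := `|p - q|; have D0 : 0 < D by rewrite normr_gt0 subr_eq0.
pose d := Num.min (D / 4) (Num.min e e').
have d0 : 0 < d by rewrite !lt_min e0 e'0 divr_gt0.
have [dD de de'] : [/\ d <= D / 4, d <= e & d <= e'].
  by rewrite !ge_min !lexx !orbT.
pose C := M * d + `|V p - V q| + M' * d.
have C0 : 0 <= C by rewrite !addr_ge0// mulr_ge0// ltW.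
exists (C / (D / 2)), d; split=> // a b pa qb Xa Xb.
have Vpa : `|V p - V a| <= M * d.
  rewrite (le_trans (VM _ _ (ballxx _ e0) (le_ball de pa) Xp Xa))//.
  by rewrite ler_wpM2l// ltW//; move: pa; rewrite -ball_normE.
have Vqb : `|V q - V b| <= M' * d.
  rewrite (le_trans (VM' _ _ (ballxx _ e'0) (le_ball de' qb) Xq Xb))//.
  by rewrite ler_wpM2l// ltW//; move: qb; rewrite -ball_normE.
apply: (@le_trans _ _ C).
  rewrite (_ : V a - V b = - (V p - V a) + (V p - V q) + (V q - V b));
    last first.
    by rewrite opprB -addrA !subrKA.
  apply: (le_trans (ler_normD _ _)); rewrite lerD//.
  by apply: (le_trans (ler_normD _ _)); rewrite lerD// normrN.
rewrite -mulrA ler_peMr// ler_pdivlMl ?divr_gt0// mulr1.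
have : D <= `|p - a| + `|a - b| + `|q - b|.
  rewrite /D (_ : p - q = (p - a) + (a - b) + - (q - b)); last first.
    by rewrite opprB -addrA !subrKA.
  by rewrite (le_trans (ler_normD _ _))// normrN lerD// ler_normD.
move: pa qb; rewrite -ball_normE /= => pa qb D_le.
have {}pa := lt_le_trans pa dD; have {}qb := lt_le_trans qb dD.
lra.
Qed.

End local_lipschitz.

Section dini_theory.
Context {R : realType} {m : nat}.
Implicit Types (X : set 'rV[R]_m) (V : 'rV[R]_m -> R) (L : R).

(** This form needs no case distinction when there is no small admissible [h]:
    the limit superior is then -oo and the condition is vacuous. *)
Lemma dini_leP X V x y L :
  (dini X V x y <= L%:E)%E <->
  forall e, 0 < e -> \forall h \near 0^'+, X (x + h *: y) ->
    (V (x + h *: y) - V x) / h <= L + e.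
Proof.
split=> [dL e e0|dL].
  have /ereal_inf_lt[_ [B FB <-] supB] : (dini X V x y < (L + e)%:E)%E.
    by rewrite (le_lt_trans dL)// lte_fin ltrDl.
  have {}FB : \forall h \near 0^'+, X (x + h *: y) -> B h by exact: FB.
  apply: filterS FB => h XB /XB Bh.
  rewrite -lee_fin (le_trans _ (ltW supB))//.
  by apply: ereal_sup_ubound; exists h.
apply/lee_addgt0Pr => e e0; rewrite -EFinD.
pose q h := (V (x + h *: y) - V x) / h.
apply: ge_ereal_inf.
exists (ereal_sup ((fun h => (q h)%:E) @` [set h | q h <= L + e])).
  by exists [set h | q h <= L + e]; [exact: dL e0|].
by apply: ge_ereal_sup => _ [h hL <-]; rewrite lee_fin.
Qed.

End dini_theory.

(** * The maximum of the rescaled functions *)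

(** Outside [A] this is the local Lipschitz condition.  On [A] the function
    vanishes, and near [x] in [A] it is squeezed by [psi] of the distance to
    [A], itself at most the Euclidean distance to [x]. *)
Lemma lyapunov_continuous {R : realType} {m : nat} (X A : set 'rV[R]_m)
    (V : 'rV[R]_m -> R) (psi : R -> R) :
  closed A -> (forall x, X x -> 0 <= V x) ->
  locally_lipschitz_outside X A V -> class_K psi ->
  (forall x, X x -> V x <= psi (set_dist A x)) ->
  forall x, X x -> V z @[z --> within X (nbhs x)] --> V x.
Proof.
move=> clA V0 lipV Kpsi Vpsi x Xx; have nbhsF := nbhs_filter x.
have [_ _ psi0] := Kpsi; have [/subspace_continuousP cpsi _ _] := Kpsi.
apply/cvgrPdist_lt => e e0; have [Ax|nAx] := pselect (A x).
  have -> : V x = 0.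
    apply/eqP; rewrite eq_le V0// andbT.
    by have := Vpsi _ Xx; rewrite set_dist_eq0// psi0.
  have psi_lt : \forall t \near 0, 0 <= t -> psi t < e.
    have := cpsi 0; rewrite /= in_itv/= lexx /from_subspace psi0.
    move=> /(_ isT)/cvgrPdist_lt/(_ e e0); rewrite near_withinE.
    apply: filterS => t; rewrite /= in_itv/= andbT sub0r normrN.
    by move=> + t0 => /(_ t0); exact/le_lt_trans/ler_norm.
  have dist_cvg : enorm (z - x) @[z --> nbhs x] --> (0 : R).
    rewrite -[X in _ --> X](@enorm0 R m) -(subrr x).
    apply: (@cvg_comp _ _ _ (fun z => z - x) (@enorm R m) _ (nbhs (x - x))).
      by apply: cvgB; [exact: cvg_id|exact: cvg_cst].
    exact: enorm_continuous.
  move: (dist_cvg _ psi_lt); rewrite near_withinE /= !nbhs_simpl/=.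
  apply: filterS => z /(_ (enorm_ge0 _)) + Xz; apply: le_lt_trans.
  rewrite sub0r normrN ger0_norm ?V0// (le_trans (Vpsi _ Xz))//.
  apply: class_K_le => //; last exact: set_dist_le.
  by apply: set_dist_ge0; exists x.
have [M [d [M0 d0 VM]]] := locally_lipschitz_outside_ball lipV clA Xx nAx.
have e'0 : 0 < Num.min d (e / (M + 1)) by rewrite lt_min d0 divr_gt0// ltr_wpDl.
rewrite near_withinE; apply: filterS (nbhsx_ballx x _ e'0) => z xz Xz.
have xd : ball x d z by apply: le_ball xz; rewrite ge_min lexx.
rewrite (le_lt_trans (VM _ _ (ballxx _ d0) xd Xx Xz))//.
move: xz; rewrite -ball_normE /= lt_min => /andP[_].
rewrite ltr_pdivlMr ?ltr_wpDl// mulrDr mulr1 mulrC.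
by apply: le_lt_trans; rewrite lerDl.
Qed.

Section max_of_subsystems.
Context {R : realType} {n : nat} {N : 'I_n -> nat}.
Variables (X A : forall i, set 'rV[R]_(N i)) (V : forall i, 'rV[R]_(N i) -> R).
Variable (s : 'I_n -> R).
Arguments X i _ : clear implicits.
Arguments A i _ : clear implicits.
Arguments V i _ : clear implicits.
Hypothesis n_gt0 : (0 < n)%N.
Hypothesis s_gt0 : forall i, 0 < s i.
Hypothesis V_ge0 : forall i z, X i z -> 0 <= V i z.
Hypothesis V_cvg : forall i x, X i x ->
  V i z @[z --> within (X i) (nbhs x)] --> V i x.
Let W x := \big[Num.max/0]_(i < n) ((s i)^-1 * V i (submxrow x i)).

Lemma scaled_ge0 x i : setprod_blocks X x -> 0 <= (s i)^-1 * V i (submxrow x i).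
Proof. by move=> Xx; rewrite mulr_ge0 ?invr_ge0 ?(ltW (s_gt0 i)) ?V_ge0//. Qed.

Lemma scaled_le_max x i : (s i)^-1 * V i (submxrow x i) <= W x.
Proof.
exact: (@le_bigmax _ _ _ 0 (fun i => (s i)^-1 * V i (submxrow x i))).
Qed.

Lemma max_attained x : setprod_blocks X x ->
  exists i, W x = (s i)^-1 * V i (submxrow x i).
Proof. by move=> Xx; apply: bigmax_attained => // i; exact: scaled_ge0. Qed.

Lemma max_active_near x : setprod_blocks X x ->
  \forall z \near within (setprod_blocks X) (nbhs x), forall i,
    (s i)^-1 * V i (submxrow z i) = W z -> (s i)^-1 * V i (submxrow x i) = W x.
Proof.
move=> Xx; have nbhsF := nbhs_filter x.
apply: (active_near (l := fun i => (s i)^-1 * V i (submxrow x i))) => i.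
  exact: scaled_ge0.
apply: cvgM; first exact: cvg_cst.
apply: (@cvg_comp _ _ _ (fun z => submxrow z i) (V i) _ _ _ _ (V_cvg (Xx i))).
move=> U; rewrite /= !nbhs_simpl/= => /(@submxrow_continuous _ _ _ i x).
by rewrite /= !nbhs_simpl/=; apply: filterS => z Uz /(_ i); exact: Uz.
Qed.

(** To bound [W a - W b] from above, use an index active at [a].  It is active
    at [x], hence [V i] is Lipschitz near [x_i].  Exchanging [a] and [b] gives
    the other bound. *)
Lemma max_locally_lipschitz : (forall i, closed (A i)) ->
  (forall i z, A i z -> X i z -> V i z = 0) ->
  (forall i z, X i z -> ~ A i z -> 0 < V i z) ->
  (forall i, locally_lipschitz_outside (X i) (A i) (V i)) ->
  locally_lipschitz_outside (setprod_blocks X) (setprod_blocks A) W.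
Proof.
move=> clA VA0 V_gt0 lipV; apply: locally_lipschitz_outside_of_ball => x Xx nAx.
have Wx : 0 < W x.
  have [i nAi] : exists i, ~ A i (submxrow x i) by exact/existsNP.
  apply: lt_le_trans (scaled_le_max x i).
  by rewrite mulr_gt0 ?invr_gt0// V_gt0.
(* Inactive indices get the dummy pair [(0, 1)], which is never consulted. *)
have /choice[Me lipMe] : forall i, exists Me : R * R,
    [/\ 0 <= Me.1, 0 < Me.2 & (s i)^-1 * V i (submxrow x i) = W x ->
    forall a b, ball (submxrow x i) Me.2 a -> ball (submxrow x i) Me.2 b ->
      X i a -> X i b -> `|V i a - V i b| <= Me.1 * `|a - b|].
  move=> i; have [act|nact] := pselect ((s i)^-1 * V i (submxrow x i) = W x).
    have nAi : ~ A i (submxrow x i).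
      by move=> Ai; move: Wx; rewrite -act (VA0 i _ Ai (Xx i)) mulr0 ltxx.
    have [M [e [M0 e0 VM]]] :=
      locally_lipschitz_outside_ball (lipV i) (clA i) (Xx i) nAi.
    by exists (M, e).
  by exists (0, 1).
have := max_active_near Xx; rewrite near_withinE => /nbhs_ballP[d /= d0 act].
pose e := \big[Num.min/d]_(i < n) (Me i).2.
pose M := \sum_(i < n) (s i)^-1 * (Me i).1.
have M_term i : 0 <= (s i)^-1 * (Me i).1.
  by rewrite mulr_ge0 ?invr_ge0 ?(ltW (s_gt0 i))//; have [] := lipMe i.
have half a b : ball x e a -> ball x e b -> setprod_blocks X a ->
    setprod_blocks X b -> W a - W b <= M * `|a - b|.
  move=> xa xb Xa Xb; have [i Wa] := max_attained Xa.
  have xd : ball x d a by apply: le_ball xa; exact: bigmin_le_id.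
  have [_ _ /(_ (act _ xd Xa _ (esym Wa)))lip] := lipMe i.
  have blk c : ball x e c -> ball (submxrow x i) (Me i).2 (submxrow c i).
    rewrite -!ball_normE /= -submxrowB => xc.
    rewrite (le_lt_trans (mx_norm_block_le _ _))// (lt_le_trans xc)//.
    exact: bigmin_le.
  rewrite Wa (le_trans (lerB (lexx _) (scaled_le_max b i)))// -mulrBr.
  have {}lip := lip _ _ (blk _ xa) (blk _ xb) (Xa i) (Xb i).
  have le1 : V i (submxrow a i) - V i (submxrow b i) <= (Me i).1 * `|a - b|.
    rewrite (le_trans (ler_norm _))// (le_trans lip)// -submxrowB.
    by rewrite ler_wpM2l ?mx_norm_block_le//; have [] := lipMe i.
  apply: (@le_trans _ _ ((s i)^-1 * (Me i).1 * `|a - b|)).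
    by rewrite -mulrA ler_wpM2l// invr_ge0 ltW.
  by rewrite ler_wpM2r// /M (bigD1 i)//= lerDl sumr_ge0.
exists M, e; split.
- by apply: sumr_ge0 => i _.
- by apply: lt_bigmin => // i _; have [] := lipMe i.
- move=> a b xa xb Xa Xb; rewrite ler_norml half// andbT.
  by rewrite lerNl opprB distrC half.
Qed.

(** For small [h] the maximum at [x + h *: y] is attained at an index active at
    [x], so the difference quotient of [W] is one of [V i / s i] for an active
    [i].  The admissible [h] for the product are admissible for each factor. *)
Lemma dini_max_le x y L : setprod_blocks X x ->
  (forall i, (s i)^-1 * V i (submxrow x i) = W x ->
    (dini (X i) (V i) (submxrow x i) (submxrow y i) <= (s i * L)%:E)%E) ->
  (dini (setprod_blocks X) W x y <= L%:E)%E.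
Proof.
move=> Xx dV; apply/dini_leP => e e0.
have subE h i : submxrow (x + h *: y) i = submxrow x i + h *: submxrow y i.
  by apply/matrixP => k j; rewrite !mxE.
have act : \forall h \near 0^'+, setprod_blocks X (x + h *: y) -> forall i,
    (s i)^-1 * V i (submxrow (x + h *: y) i) = W (x + h *: y) ->
    (s i)^-1 * V i (submxrow x i) = W x.
  have := max_active_near Xx; rewrite near_withinE => actx.
  have : x + h *: y @[h --> 0^'+] --> x.
    apply: cvg_at_right_filter; rewrite -[X in _ --> X]addr0 -(scale0r y).
    apply: cvgD; first exact: cvg_cst.
    by apply: cvgZ; [exact: cvg_id|exact: cvg_cst].
  by move=> /(_ _ actx); rewrite /= !nbhs_simpl.
have quot : \forall h \near 0^'+, forall i,
    (s i)^-1 * V i (submxrow x i) = W x -> setprod_blocks X (x + h *: y) ->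
    (V i (submxrow (x + h *: y) i) - V i (submxrow x i)) / h <= s i * (L + e).
  apply: filter_forall => i.
  have [acti|nact] := pselect ((s i)^-1 * V i (submxrow x i) = W x); last first.
    by apply: nearW.
  have /dini_leP/(_ (s i * e)) := dV i acti; rewrite mulr_gt0// => /(_ isT).
  apply: filterS => h Vh _ Xh; rewrite mulrDr subE; apply: Vh.
  by rewrite -subE; exact: Xh.
have h_gt0 : \forall h \near (0 : R)^'+, 0 < h by exact: nbhs_right_gt.
apply: filterS (filterI h_gt0 (filterI act quot)) => h [h0 [acth quoth]] Xh.
have [i Wi] := max_attained Xh; have acti := acth Xh i (esym Wi).
by rewrite Wi -acti -mulrBr -mulrA ler_pdivrMl// quoth.
Qed.

(** Some block carries at least the [n]-th part of the distance to the product,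
    which yields the lower bound; no block is farther from its factor than
    [x] from the product, which yields the upper one. *)
Lemma max_sandwich : (forall i, A i !=set0) ->
  (forall i, exists psi1 psi2 : R -> R,
    [/\ class_Kinf psi1, class_Kinf psi2 & forall z, X i z ->
       psi1 (set_dist (A i) z) <= V i z <= psi2 (set_dist (A i) z)]) ->
  exists psi1 psi2 : R -> R,
    [/\ class_Kinf psi1, class_Kinf psi2 & forall x, setprod_blocks X x ->
       psi1 (set_dist (setprod_blocks A) x) <= W x
         <= psi2 (set_dist (setprod_blocks A) x)].
Proof.
move=> A0 /choice[psi1 /choice[psi2 psiV]].
have si0 i : 0 < (s i)^-1 by rewrite invr_gt0.
have [lo Klo lo_le] : exists2 lo, class_Kinf lo &
    forall i r, lo r <= (s i)^-1 * psi1 i r.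
  by apply: class_Kinf_lower => i; apply: class_KinfZ => //; have [] := psiV i.
have [up Kup up_ge] : exists2 up, class_Kinf up &
    forall i r, 0 <= r -> (s i)^-1 * psi2 i r <= up r.
  by apply: class_K_upper => i; apply: class_KZ => //; have [_ []] := psiV i.
exists (fun r => lo (n%:R^-1 * r)), up; split=> //.
  by apply: class_Kinf_scale => //; rewrite invr_gt0 ltr0n.
move=> x Xx; apply/andP; split.
  have [i far] : exists i, n%:R^-1 * set_dist (setprod_blocks A) x <=
      set_dist (A i) (submxrow x i).
    have [i maxi] :=
      bigmax_attained n_gt0 (fun i => set_dist_ge0 (submxrow x i) (A0 i)).
    exists i; rewrite ler_pdivrMl ?ltr0n//.
    rewrite (le_trans (set_dist_le_sum_blocks x A0))//.
    rewrite mulr_natl -[X in _ *+ X]card_ord -sumr_const ler_sum// => j _.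
    by rewrite -maxi (le_bigmax _ (fun i => set_dist (A i) (submxrow x i))).
  apply: le_trans (scaled_le_max x i); apply: le_trans (lo_le i _) _.
  rewrite ler_pM2l//; have [[K1 _] _ /(_ _ (Xx i))/andP[+ _]] := psiV i.
  apply: le_trans; apply: class_K_le => //.
  rewrite mulr_ge0 ?invr_ge0 ?ler0n// set_dist_ge0//.
  exact: setprod_blocks_nonempty.
have [i ->] := max_attained Xx.
have [_ [K2 _] /(_ _ (Xx i))/andP[_ le2]] := psiV i.
apply: le_trans (_ : (s i)^-1 * psi2 i (set_dist (A i) (submxrow x i)) <= _).
  by rewrite ler_pM2l.
rewrite (le_trans (up_ge i _ (set_dist_ge0 _ (A0 i))))//.
apply: class_K_le Kup.1 (set_dist_ge0 _ (A0 i)) _; exact: set_dist_block_le.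
Qed.

End max_of_subsystems.

(** * Rates of the interconnection *)

Section rates.
Context {R : realType} {n : nat}.

Lemma fine_bigmin_le (I : finType) (P : pred I) (f : I -> \bar R) i r :
  P i -> (f i <= r%:E)%E -> (forall j, P j -> (-oo < f j)%E) ->
  fine (\big[Order.min/+oo%E]_(j | P j) f j) <= r.
Proof.
move=> Pi fir fNy; have minNy : (-oo < \big[Order.min/+oo%E]_(j | P j) f j)%E.
  exact: lt_bigmin.
have : (\big[Order.min/+oo%E]_(j | P j) f j <= r%:E)%E by apply: bigmin_inf fir.
by case: (\big[_/_]_(j | _) _) minNy.
Qed.

Lemma flow_rate_le (c : 'I_n -> R) i : flow_rate c <= c i.
Proof. by apply: (@fine_bigmin_le _ _ _ i) => // j _; exact: ltNyr. Qed.

Lemma oppe_lneNy (r : R) : (-oo < - lne r%:E)%E.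
Proof. by rewrite /lne; case: ifP => _; rewrite //= ltNyr. Qed.

Lemma jump_rate_min (d s : 'I_n -> R) (chi : 'M[R]_n) i j r : j != i ->
  (Order.min (d i)%:E (- lne (s j / s i * chi i j)%:E) <= r%:E)%E ->
  jump_rate d s chi <= r.
Proof.
have termNy k l : (-oo < Order.min (d k)%:E (- lne (s l / s k * chi k l)%:E))%E.
  by rewrite lt_min ltNyr oppe_lneNy.
move=> ji ler; apply: (@fine_bigmin_le _ _ _ i) => // [|k _].
  exact: bigmin_inf ler.
by apply: lt_bigmin.
Qed.

Lemma jump_rate_le (d s : 'I_n -> R) (chi : 'M[R]_n) i : (1 < n)%N ->
  jump_rate d s chi <= d i.
Proof.
move=> n1; have [j ji] : exists j, j != i.
  have n0 : (0 < n)%N by exact: ltnW.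
  have [->|] := eqVneq i (Ordinal n0); first by exists (Ordinal n1).
  by exists (Ordinal n0); rewrite eq_sym.
by apply: (jump_rate_min ji); rewrite ge_min lexx.
Qed.

Lemma gain_le_expR_jump_rate (d s : 'I_n -> R) (chi : 'M[R]_n) i j : j != i ->
  s j / s i * chi i j <= expR (- jump_rate d s chi).
Proof.
move=> ji; have [t0|t0] := leP (s j / s i * chi i j) 0.
  by rewrite (le_trans t0)// expR_ge0.
rewrite -[leLHS](lnK (_ : _ \is Num.pos))// ler_expR lerNr.
by apply: (jump_rate_min ji); rewrite lne_EFin// ge_min lexx orbT.
Qed.

End rates.

(** * The interconnection *)

Theorem theorem4 (R : realType) (n : nat) (N : 'I_n -> nat) (M : nat)
    (Sigma : interconnection R N M)
    (A : forall i : 'I_n, set 'rV[R]_(N i))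
    (V : forall i : 'I_n, 'rV[R]_(N i) -> R)
    (c d : 'I_n -> R) (chi : 'M[R]_n) (s : 'I_n -> R)
    (n_ge2 : (2 <= n)%N)
    (A_compact : forall i,
      [/\ A i !=set0, compact (A i) & A i `<=` ic_X Sigma i])
    (chi_ge0 : forall i j, 0 <= chi i j)
    (chi_diag : forall i, chi i i = 0)
    (V_lyapunov : forall i,
      exp_ISS_lyapunov_sub Sigma chi V (A i) (c i) (d i))
    (small_gain : spectral_radius chi < 1)
    (s_path : Omega_path (fun v : 'cV[R]_n => chi *m v)
      (fun i r => s i * r)) :
  exp_ISS_lyapunov (whole_system Sigma) (setprod_blocks A)
    (fun x => \big[Num.max/0]_(i < n) ((s i)^-1 * V i (submxrow x i)))
    (flow_rate c) (jump_rate d s chi).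
Proof.
have n0 : (0 < n)%N by exact: ltnW.
have A0 i : A i !=set0 by have [] := A_compact i.
have clA i : closed (A i).
  have [_ cA _] := A_compact i; exact: compact_closed (@norm_hausdorff _ _) cA.
have [sK _ _ s_gain] := s_path.
have s0 i : 0 < s i by have := class_K_gt0 (sK i).1 ltr01; rewrite mulr1.
have si0 i : 0 < (s i)^-1 by rewrite invr_gt0.
have gain i j : chi i j * s j <= s i.
  have := s_gain 1 ltr01 i; rewrite mulr1 => /ltW; apply: le_trans.
  rewrite !mxE (bigD1 j)//= mxE mulr1 lerDl sumr_ge0// => k _.
  by rewrite mxE mulr1 mulr_ge0// ltW.
have V0 i z : ic_X Sigma i z -> 0 <= V i z.
  by have [+ _ _ _] := V_lyapunov i; exact.
have lipV i : locally_lipschitz_outside (ic_X Sigma i) (A i) (V i).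
  by have [_ + _ _] := V_lyapunov i.
have psiV : forall i, exists psi1, exists psi2 : R -> R,
    [/\ class_Kinf psi1, class_Kinf psi2 & forall z, ic_X Sigma i z ->
       psi1 (set_dist (A i) z) <= V i z <= psi2 (set_dist (A i) z)].
  by move=> i; have [_ _ + _] := V_lyapunov i.
have V_cvg i x : ic_X Sigma i x ->
    V i z @[z --> within (ic_X Sigma i) (nbhs x)] --> V i x.
  have [psi1 [psi2 [_ K2 psi]]] := psiV i.
  apply: (lyapunov_continuous (clA i) (V0 i) (lipV i) K2.1) => z Xz.
  by have /andP[] := psi z Xz.
have VA0 i z : A i z -> ic_X Sigma i z -> V i z = 0.
  move=> Az Xz; have [psi1 [psi2 [_ [[_ _ psi0] _] psi]]] := psiV i.
  have /andP[_] := psi z Xz.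
  by rewrite set_dist_eq0// psi0 => Vz; apply/eqP; rewrite eq_le Vz V0.
have V_gt0 i z : ic_X Sigma i z -> ~ A i z -> 0 < V i z.
  move=> Xz nAz; have [psi1 [psi2 [[K1 _] _ psi]]] := psiV i.
  have /andP[le1 _] := psi z Xz.
  exact: lt_le_trans (class_K_gt0 K1 (set_dist_gt0 (A0 i) (clA i) nAz)) le1.
(* The nested maxima of the hypotheses become one inequality per term. *)
have /choice[chiu chiuP] : forall i, exists chiu : R -> R,
    [/\ class_K chiu,
        forall x u, flow_set Sigma (x, u) -> ~ A i (submxrow x i) ->
          (forall j, chi i j * V j (submxrow x j) <= V i (submxrow x i)) ->
          chiu (enorm u) <= V i (submxrow x i) ->
          forall y, ic_F Sigma i x u y ->
            (dini (ic_X Sigma i) (V i) (submxrow x i) y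
               <= (- c i * V i (submxrow x i))%:E)%E &
        forall x u, jump_set Sigma (x, u) -> forall y, ic_G Sigma i x u y ->
          forall B, expR (- d i) * V i (submxrow x i) <= B ->
            (forall j, chi i j * V j (submxrow x j) <= B) ->
            chiu (enorm u) <= B -> V i y <= B].
  move=> i; have [_ _ _ [chiu [Kchiu flow jump]]] := V_lyapunov i.
  exists chiu.
  split=> // [x u xu nAx intern extern|x u xu y yG B dB intern extern].
    apply: flow => //; rewrite ge_max extern andbT; apply: bigmax_le => //.
    by apply: V0; apply: ic_CX; case: xu => /(_ i).
  rewrite (le_trans (jump _ _ xu _ yG))// !ge_max dB extern andbT/=.
  apply: bigmax_le => //; apply: le_trans dB; rewrite mulr_ge0 ?expR_ge0//.
  by apply: V0; apply: ic_DX; case: xu => /(_ i).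
pose X := setprod_blocks (ic_X Sigma).
pose W x := \big[Num.max/0]_(i < n) ((s i)^-1 * V i (submxrow x i)).
have W_ge x i : V i (submxrow x i) <= s i * W x.
  by rewrite -ler_pdivrMl//; exact: scaled_le_max.
have W_gain x i j : chi i j * V j (submxrow x j) <=
    s j / s i * chi i j * (s i * W x).
  rewrite (le_trans (ler_wpM2l (chi_ge0 i j) (W_ge x j)))//.
  by rewrite le_eqVlt; apply/orP; left; apply/eqP; field; rewrite gt_eqF.
have W0 x : X x -> 0 <= W x by move=> Xx; exact: bigmax_ge_id.
have subX : setprod_blocks A `<=` X.
  by move=> x Ax i; have [_ _] := A_compact i; apply; exact: Ax.
split.
- split; [exact: setprod_blocks_nonempty| |exact subX].
  by apply: setprod_blocks_compact => i; have [] := A_compact i.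
- exact W0.
- exact: (max_locally_lipschitz n0 s0 V0 V_cvg clA VA0 V_gt0 lipV).
- exact: max_sandwich.
have [up Kup up_ge] : exists2 up, class_Kinf up &
    forall i r, 0 <= r -> (s i)^-1 * chiu i r <= up r.
  by apply: class_K_upper => i; apply: class_KZ => //; have [] := chiuP i.
set D := jump_rate d s chi.
have upK r : 0 <= r -> 0 <= up r by move=> r0; exact: class_K_ge0 Kup.1 r0.
have chiu_le i (u : 'rV[R]_M) : chiu i (enorm u) <= s i * up (enorm u).
  by rewrite -ler_pdivrMl// up_ge// enorm_ge0.
(* The summand 1 serves the flow, [expR D] the external term of the jumps: the
   gain is below [W x] only if [up] is below both [W x] and
   [expR (- D) * W x]. *)
exists (fun r => (1 + expR D) * up r); split.
- by apply: class_KZ Kup.1; rewrite addr_gt0// expR_gt0.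
- move=> x u xu nAx extern y yF; have [xC _] := xu.
  have Xx : X x by move=> i; exact/ic_CX/xC.
  have up_le : up (enorm u) <= W x.
    apply: le_trans extern; rewrite ler_peMl ?upK ?enorm_ge0//.
    by rewrite lerDl expR_ge0.
  apply: (dini_max_le n0 s0 V0 V_cvg) => // i acti.
  have Vi : V i (submxrow x i) = s i * W x.
    by rewrite -/(W x) -[W x]acti mulrA divff ?mul1r ?gt_eqF.
  have [_ flow _] := chiuP i.
  apply: (le_trans (flow x u xu _ _ _ _ (yF i))).
  (* [W x] is positive as some block is outside its factor, whereas [V i]
     vanishes on [A i]. *)
  + move=> Ai; have /existsNP[j nAj] := nAx.
    have := lt_le_trans (V_gt0 j _ (Xx j) nAj) (W_ge x j).
    by rewrite pmulr_rgt0// -(pmulr_rgt0 _ (s0 i)) -Vi (VA0 i _ Ai (Xx i)) ltxx.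
  + move=> j; rewrite (le_trans (ler_wpM2l (chi_ge0 i j) (W_ge x j)))//.
    by rewrite Vi mulrA ler_wpM2r ?W0.
  + by rewrite (le_trans (chiu_le i u))// Vi ler_pM2l.
  + rewrite lee_fin Vi mulrCA ler_pM2l// ler_wpM2r ?W0// lerN2.
    exact: flow_rate_le.
- move=> x u xu extern y yG; have [xD _] := xu.
  have Xx : X x by move=> i; exact/ic_DX/xD.
  have up_le : up (enorm u) <= expR (- D) * W x.
    rewrite expRN ler_pdivlMl ?expR_gt0//; apply: le_trans extern.
    by rewrite ler_wpM2r ?upK ?enorm_ge0// lerDr.
  apply: bigmax_le => [|i _]; first by rewrite mulr_ge0 ?expR_ge0 ?W0.
  rewrite ler_pdivrMl//; have [_ _ jump] := chiuP i.
  apply: (jump x u xu _ (yG i)).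
  + rewrite mulrCA (le_trans (ler_wpM2l (expR_ge0 _) (W_ge x i)))//.
    rewrite ler_wpM2r ?mulr_ge0 ?W0 ?(ltW (s0 i))// ler_expR lerN2.
    exact: jump_rate_le.
  + move=> j; have [->|ji] := eqVneq j i.
      by rewrite chi_diag mul0r !mulr_ge0 ?expR_ge0 ?W0// ltW.
    rewrite (le_trans (W_gain x i j))// [leRHS]mulrCA.
    by rewrite ler_wpM2r ?mulr_ge0 ?W0 ?(ltW (s0 i))// gain_le_expR_jump_rate.
  + by rewrite (le_trans (chiu_le i u))// ler_pM2l.
Qed.
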